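(* For each $n$, let $\pi$ be a uniformly random permutation of $\{1,\dots,n\}$. Then there are sets $\mathcal{M}=\mathcal{M}_n$ of positive integers such that: (1) $\sup_{m \notin \mathcal{M}_n} \mathbf{P}(\operatorname{ord} \pi = m) = O(n^{-100})$ as $n\to\infty$; (2) $\mathbf{P}(\operatorname{ord} \pi \in \mathcal{M}_n) \leq n^{-1+o(1)}$ as $n\to\infty$.
   Context: For a permutation $\pi$, $\operatorname{ord}\pi$ denotes its order, i.e. the least common multiple of its cycle lengths. The notation $n^{-1+o(1)}$ means $n^{-1+\epsilon(n)}$ for some function $\epsilon(n)\to 0$ as $n\to\infty$. *)

(* Defs.v *)
From mathcomp Require Import all_boot all_order all_algebra all_fingroup.
From mathcomp Require Import all_classical all_reals all_analysis.

Set Implicit Arguments.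
Unset Strict Implicit.
Unset Printing Implicit Defensive.

Import numFieldNormedType.Exports.

Local Open Scope classical_set_scope.
Local Open Scope ring_scope.

Definition unif_prob (R : realType) (T : finType) (E : pred T) : R :=
  #|E|%:R / #|T|%:R.

(* The group order #[s]%g of s : 'S_n is its order as a permutation of 'I_n;
   'I_n plays the role of {1, ..., n}. *)
Definition prob_ord_eq (R : realType) (n m : nat) : R :=
  unif_prob R [pred s : 'S_n | #[s]%g == m].

Definition prob_ord_in (R : realType) (n : nat) (A : set nat) : R :=
  unif_prob R [pred s : 'S_n | #[s]%g \in A].

(* Main.v *)
(**
  Let [M n] be the set of orders that occur with probability more than
  [n ^- 100]. Bounding the probability of [M n] takes two estimates, both based
  on exposing the permutation cycle by cycle: the length of the cycle through
  a point is uniform on [1 .. N] when [N] points remain. Lengths are weighted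
  by the power 1/4 of their part supported on a given set of primes, whose
  average is controlled by the Euler product of [p ^ (-3/4)].

  1. If an order has a divisor [d >= n ^ (4 B)] made of [O(log n)] primes
     exceeding the square of their number, then it has probability at most
     [n ^ O(1) / d ^ (1/4)], by Markov's inequality applied to the product over
     the cycles of the weights at the primes of [d]. So it is not in [M n].

  2. Fix [delta > 0] and a large constant [K]. Either fewer than [K] cycles are
     exposed before at most [n ^ delta] points remain, which has probability
     [n ^ (-1 + delta + o(1))], or each of the first [K] cycles multiplies the
     part of the order coprime to the small primes by a factor whose inverse
     1/4-th power has average at most [n ^ (- delta / 4 + o(1))]. Markov's
     inequality then shows that the order has a divisor as in 1, outside an
     event of probability [1 / n].
*)

Require Import Defs.
From mathcomp Require Import all_boot all_order all_algebra all_fingroup.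
From mathcomp Require Import all_classical all_reals all_analysis.
From mathcomp Require Import cyclic ring lra zify.


Set Implicit Arguments.
Unset Strict Implicit.
Unset Printing Implicit Defensive.

Import Order.TTheory GRing.Theory Num.Theory.
Import numFieldNormedType.Exports.

(** * Exposing a permutation cycle by cycle *)

Lemma leq_card_bigcup (I T : finType) (P : pred I) (A_ : I -> {set T}) :
  #|\bigcup_(i | P i) A_ i| <= \sum_(i | P i) #|A_ i|.
Proof.
elim/big_rec2: _ => [|i m B _ leB]; first by rewrite cards0.
apply: leq_trans (_ : #|A_ i| + #|B| <= _); last by rewrite leq_add2l.
by rewrite cardsU leq_subr.
Qed.

Section CycleExposure.

Variable T : finType.
Implicit Types (s : {perm T}) (a x : T) (A : {set T}).

Lemma porbit_dvdn s a m : ((s ^+ m)%g a == a) = (#|porbit s a| %| m).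
Proof.
have c0 : 0 < #|porbit s a| by rewrite lt0n card_porbit_neq0.
have fixM k : (s ^+ (k * #|porbit s a|))%g a = a.
  elim: k => [|k IH]; first by rewrite mul0n expg0 perm1.
  by rewrite mulSn expgD permM [(s ^+ #|_|)%g a]permX iter_porbit.
rewrite {1}(divn_eq m #|porbit s a|) expgD permM fixM permX /dvdn.
have := ltn_pmod m c0; set r := m %% _ => lt_r.
case: (posnP r) => [->|r0]; first by rewrite /= eqxx.
apply/negbTE/eqP => E.
have := uniq_traject_porbit s a.
move/(nth_uniq a) => /(_ 0 r); rewrite size_traject => /(_ c0 lt_r).
by rewrite !nth_traject // E /= eqxx eq_sym eqn0Ngt r0.
Qed.

Lemma astabs_porbitC s a : s \in 'N(~: porbit s a | 'P)%g.
Proof.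
apply/astabsP => x; rewrite !inE /= apermE; congr (~~ _).
by rewrite -!eq_porbit_mem -(porbit_perm s 1 x) expg1.
Qed.

(** The powers of the restriction agree with those of [s] off the cycle of [a] and are trivial on
    it, so a power of [s] is trivial exactly when both components are. *)
Lemma order_lcm_porbit s a :
  #[s]%g = lcmn #|porbit s a| #[restr_perm (~: porbit s a) s]%g.
Proof.
set C := porbit s a; set s' := restr_perm _ s.
have nC := astabs_porbitC s a.
have s'X m x : x \notin C -> (s' ^+ m)%g x = (s ^+ m)%g x.
  move=> xC; rewrite /s' -morphX // restr_permE ?groupX //.
  by rewrite inE.
have s'C m x : x \in C -> (s' ^+ m)%g x = x.
  move=> xC; rewrite permX_fix //.
  by rewrite (out_perm (restr_perm_on _ _)) // inE xC.
apply/eqP; rewrite eqn_dvd; apply/andP; split; last first.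
  rewrite dvdn_lcm -porbit_dvdn expg_order perm1 eqxx /=.
  rewrite order_dvdn; apply/eqP/permP => x; rewrite perm1.
  case: (boolP (x \in C)) => [/s'C //|xC].
  by rewrite s'X // expg_order perm1.
set m := lcmn _ _.
have am : (s ^+ m)%g a = a by apply/eqP; rewrite porbit_dvdn dvdn_lcml.
have s'm : (s' ^+ m)%g = 1%g.
  by apply/eqP; rewrite -order_dvdn dvdn_lcmr.
rewrite order_dvdn; apply/eqP/permP => x; rewrite perm1.
case: (boolP (x \in C)) => [/porbitP [i ->]|xC].
  by rewrite -permM -expgD addnC expgD permM am.
by rewrite -s'X // s'm perm1.
Qed.

(** The trajectory determines the permutation on the exposed cycle, the restriction determines it
    elsewhere. *)
Lemma perm_exposed_inj a (t : seq T) s1 s2 :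
    traject s1 a #|porbit s1 a| = a :: t -> traject s2 a #|porbit s2 a| = a :: t ->
    restr_perm (~: porbit s1 a) s1 = restr_perm (~: porbit s2 a) s2 ->
  s1 = s2.
Proof.
move=> t1 t2 eq_r.
have sz s : traject s a #|porbit s a| = a :: t -> #|porbit s a| = (size t).+1.
  by move=> ts; rewrite -(size_traject s a #|porbit s a|) ts.
have sz1 := sz _ t1; have sz2 := sz _ t2.
have memC s : traject s a #|porbit s a| = a :: t -> porbit s a =i a :: t.
  by move=> ts x; rewrite porbit_traject ts.
have C1 := memC _ t1; have C2 := memC _ t2.
apply/permP => x; case: (boolP (x \in a :: t)) => [xt|xt]; last first.
  have x1 : x \in ~: porbit s1 a by rewrite inE C1.
  have x2 : x \in ~: porbit s2 a by rewrite inE C2.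
  rewrite -(restr_permE (astabs_porbitC s1 a) x1) eq_r.
  by rewrite (restr_permE (astabs_porbitC s2 a) x2).
have nthE s i : traject s a #|porbit s a| = a :: t -> i <= size t ->
    iter i s a = nth a (a :: t) i.
  by move=> ts it; rewrite -ts nth_traject // sz.
have /(nthP a) [i] := xt; rewrite /= ltnS => it <-.
rewrite -{1}(nthE s1) // -(nthE s2) // -!iterS.
move: it; rewrite leq_eqVlt => /orP [/eqP ->|it]; last by rewrite !nthE.
by rewrite -{1}sz1 -{1}sz2 !iter_porbit.
Qed.

End CycleExposure.

Definition lcms (ls : seq nat) := foldr lcmn 1 ls.

(* [F N ls] bounds the probability that the order satisfies [Q] once cycles of
   lengths [ls] have been exposed and [N] points remain. *)
Section Supersolution.

Variables (R : realType) (n : nat) (Q : pred nat) (F : nat -> seq nat -> R).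

Hypothesis F_end : forall ls, all (leq 1) ls -> sumn ls = n -> Q (lcms ls) ->
  (1 <= F 0 ls)%R.
Hypothesis F_ge0 : forall N ls, (0 <= F N ls)%R.
Hypothesis F_step : forall N ls, 0 < N -> all (leq 1) ls -> N + sumn ls = n ->
  (\sum_(l < N) F (N - l.+1) (l.+1 :: ls) <= N%:R * F N ls)%R.

Lemma card_perm_on_le (A : {set 'I_n}) (ls : seq nat) :
    all (leq 1) ls -> #|A| + sumn ls = n ->
  (#|[set s : 'S_n | perm_on A s & Q (lcmn #[s]%g (lcms ls))]|%:R
     <= (#|A|)`!%:R * F #|A| ls :> R)%R.
Proof.
move: {2}#|A| (leqnn #|A|) => m; elim: m A ls => [|m IH] A ls leAm ls0 szA.
  have A0 : A = finset.set0 by apply/eqP; rewrite -cards_eq0 -leqn0.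
  move: szA; rewrite {leAm}A0 cards0 fact0 mul1r add0n => szA.
  case: (boolP (Q (lcms ls))) => Qls; last first.
    rewrite (_ : [set s | _] = finset.set0) ?cards0 ?F_ge0 //.
    apply/finset.setP => s; rewrite !inE; apply/negP => /andP [s0].
    have -> : s = 1%g.
      by apply/permP => x; rewrite perm1 (out_perm s0) ?inE.
    by rewrite order1 lcm1n; apply/negP.
  apply: le_trans (F_end ls0 szA Qls).
  rewrite -[1%R]/(1%:R)%R ler_nat -(cards1 (1%g : 'S_n)).
  apply: subset_leq_card; apply/fintype.subsetP => s; rewrite !inE => /andP [s0 _].
  by apply/eqP/permP => x; rewrite perm1 (out_perm s0) ?inE.
case: (set_0Vmem A) => [A0|[a aA]].
  by apply: IH => //; rewrite A0 cards0.
set N := #|A| in szA leAm *; set S := [set s | _].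
have N0 : 0 < N by rewrite /N (cardsD1 a) aA.
(* The tuple [t] lists the points after [a], so the cycle has length [l.+1]. *)
pose S_ (l : nat) (t : l.-tuple 'I_n) :=
  [set s in S | traject s a #|porbit s a| == a :: t].
pose U_ (l : nat) := [set t : l.-tuple 'I_n | all (mem (A :\ a)) t & uniq t].
have leS : #|S| <= \sum_(l < N) \sum_(t in U_ l) #|S_ l t|.
  have subS : S \subset \bigcup_(l < N) \bigcup_(t in U_ l) S_ l t.
    apply/fintype.subsetP => s sS; have := sS; rewrite inE => /andP [sA _].
    have subA : porbit s a \subset A.
      apply/fintype.subsetP => x /porbitP [i ->].
      elim: i => [|i IHi]; first by rewrite expg0 perm1.
      by rewrite expgSr permM perm_closed.
    have leN : #|porbit s a| <= N by apply: subset_leq_card.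
    have c0 : 0 < #|porbit s a| by rewrite lt0n card_porbit_neq0.
    have ltN : #|porbit s a|.-1 < N by rewrite prednK.
    apply/finset.bigcupP; exists (Ordinal ltN) => //=.
    have [t Et] : exists t, traject s a #|porbit s a| = a :: t.
      by rewrite -(prednK c0) /=; eexists.
    have szt : size t == #|porbit s a|.-1.
      by rewrite -(size_traject s a #|porbit s a|) Et.
    apply/finset.bigcupP; exists (Tuple szt); last by rewrite inE sS /= Et.
    have := uniq_traject_porbit s a.
    rewrite inE /= Et /= => /andP [at_ ->]; rewrite andbT.
    apply/allP => x xt /=; rewrite in_setD1; apply/andP; split.
      by apply: contraNneq at_ => <-.
    apply: (fintype.subsetP subA); rewrite porbit_traject Et inE.
    by rewrite xt orbT.
  apply: leq_trans (subset_leq_card subS) _.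
  apply: leq_trans (leq_card_bigcup _ _) _; apply: leq_sum => l _.
  exact: leq_card_bigcup.
apply: (@le_trans _ _ (\sum_(l < N) \sum_(t in U_ l) #|S_ l t|)%:R%R).
  by rewrite ler_nat.
have leSt (l : 'I_N) (t : l.-tuple 'I_n) : t \in U_ l ->
    (#|S_ l t|%:R <= (N - l.+1)`!%:R * F (N - l.+1) (l.+1 :: ls) :> R)%R.
  rewrite inE => /andP [tA ut].
  pose B := A :\: [set x in a :: t].
  have uat : uniq (a :: t).
    rewrite /= ut andbT; apply/negP => /(allP tA).
    by rewrite !inE eqxx.
  have subB : [set x in a :: t] \subset A.
    apply/fintype.subsetP => x; rewrite !inE => /orP [/eqP -> //|/(allP tA)].
    by rewrite !inE => /andP [].
  have cB : #|B| = N - l.+1.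
    rewrite cardsDS // cardsE -/N; congr (_ - _).
    by move/card_uniqP: uat => ->; rewrite /= size_tuple.
  have := IH B (l.+1 :: ls); rewrite cB; have lN := ltn_ord l.
  have -> /= : N - l.+1 <= m by lia.
  have -> : N - l.+1 + (l.+1 + sumn ls) = n by lia.
  rewrite ls0 => /(_ isT isT erefl); apply: le_trans; rewrite ler_nat.
  rewrite -(card_in_imset (f := fun s => restr_perm (~: porbit s a) s)
    (D := mem (S_ l t))); last first.
    move=> s1 s2; rewrite !inE => /andP [_ /eqP t1] /andP [_ /eqP t2].
    exact: perm_exposed_inj t1 t2.
  apply: subset_leq_card; apply/fintype.subsetP => s' /imsetP [s].
  rewrite !inE => /andP [/andP [sA Qs] /eqP ts] ->.
  have Cs : porbit s a = [set x in a :: t].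
    by apply/finset.setP => x; rewrite porbit_traject ts inE.
  have szs : #|porbit s a| = l.+1.
    by rewrite -(size_traject s a #|porbit s a|) ts /= size_tuple.
  move: Qs; rewrite (order_lcm_porbit s a) szs -lcmnA lcmnCA => Qs.
  apply/andP; split; last exact: Qs.
  apply/fintype.subsetP => x; rewrite !inE => xs.
  have xC : x \in ~: porbit s a.
    by apply: contraR xs => xC; rewrite (out_perm (restr_perm_on _ _)).
  have := xC; rewrite inE Cs !inE => -> /=.
  apply: contraR xs => xA; rewrite restr_permE ?astabs_porbitC //.
  by rewrite (out_perm sA).
have cU (l : 'I_N) : #|U_ l| = N.-1 ^_ l.
  rewrite /U_ card_uniq_tuples; congr (_ ^_ _).
  by rewrite /N (cardsD1 a A) aA; apply: eq_card => x; rewrite !inE.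
rewrite natr_sum.
apply: (@le_trans _ _ (\sum_(l < N) N.-1`!%:R * F (N - l.+1) (l.+1 :: ls)))%R.
  apply: ler_sum => l _; rewrite natr_sum.
  apply: le_trans (ler_sum _ (fun t Ut => leSt l t Ut)) _.
  rewrite sumr_const cU -[X in (X <= _)%R]mulr_natr mulrAC -natrM.
  have lN := ltn_ord l; have lN1 : l <= N.-1 by lia.
  by rewrite -(ffact_fact lN1) mulnC (_ : N.-1 - l = N - l.+1); last lia.
have -> : N`! = N.-1`! * N by rewrite mulnC -[in LHS](prednK N0) factS prednK.
rewrite -mulr_sumr natrM -mulrA.
by apply: ler_wpM2l; [rewrite ler0n | apply: F_step].
Qed.

Lemma unif_prob_order_le : (unif_prob R [pred s : 'S_n | Q #[s]%g] <= F n [::])%R.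
Proof.
have := @card_perm_on_le [set: 'I_n] [::] isT.
rewrite cardsT card_ord addn0 => /(_ erefl) le.
rewrite /unif_prob card_Sn ler_pdivrMr ?ltr0n ?fact_gt0 // mulrC.
apply: le_trans le; rewrite ler_nat; apply: subset_leq_card.
apply/fintype.subsetP => s; rewrite !inE => Qs; rewrite lcmn1 Qs andbT.
by apply/fintype.subsetP => x; rewrite inE.
Qed.

End Supersolution.

(** * Weighted sums over smooth numbers *)

Section SmoothSums.

Variable R : realType.
Local Open Scope ring_scope.

Definition root4 (x : nat) : R := Num.sqrt (Num.sqrt x%:R).

Lemma root4_ge0 x : 0 <= root4 x. Proof. exact: sqrtr_ge0. Qed.

Lemma root4_gt0 x : (0 < x)%N -> 0 < root4 x.
Proof. by move=> x0; rewrite !sqrtr_gt0 ltr0n. Qed.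

Lemma root4X4 x : root4 x ^+ 4 = x%:R.
Proof. by rewrite -[4%N]/(2 * 2)%N exprM !sqr_sqrtr ?sqrtr_ge0. Qed.

Lemma root4M x y : root4 (x * y) = root4 x * root4 y.
Proof. by rewrite /root4 natrM !sqrtrM ?sqrtr_ge0. Qed.

Lemma le_root4 (a : R) x : 0 <= a -> (a <= root4 x) = (a ^+ 4 <= x%:R).
Proof. by move=> a0; rewrite -root4X4 ler_pXn2r // nnegrE root4_ge0. Qed.

Lemma root4_le x y : (x <= y)%N -> root4 x <= root4 y.
Proof. by move=> xy; rewrite le_root4 ?root4_ge0 // root4X4 ler_nat. Qed.

Lemma root4_exp4 x : root4 (x ^ 4) = x%:R.
Proof.
apply/eqP; rewrite -(@eqrXn2 _ 4) ?root4_ge0 ?ler0n //.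
by rewrite root4X4 natrX.
Qed.

Lemma root4_1 : root4 1 = 1. Proof. exact: (root4_exp4 1). Qed.

Lemma root4_sqr_le x : root4 (x ^ 2) <= x%:R.
Proof.
by rewrite -root4_exp4 root4_le //; case: x => // x; rewrite leq_pexp2l.
Qed.

(* x ^ (-3/4), with value 0 at x = 0 *)
Definition h4 (x : nat) : R := root4 x / x%:R.

Lemma h4_ge0 x : 0 <= h4 x.
Proof. by rewrite divr_ge0 ?root4_ge0. Qed.

Lemma h4E x : h4 x = (root4 x ^+ 3)^-1.
Proof.
case: (posnP x) => [->|x0].
  by rewrite /h4 invr0 mulr0 /root4 !sqrtr0 expr0n invr0.
rewrite /h4 -root4X4 exprS invfM mulrA divff ?mul1r //.
by rewrite gt_eqF ?root4_gt0.
Qed.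

Lemma h4M x y : h4 (x * y) = h4 x * h4 y.
Proof. by rewrite /h4 root4M natrM invfM mulrACA. Qed.

Lemma h4_1 : h4 1 = 1.
Proof. by rewrite /h4 root4_1 divr1. Qed.

Lemma h4_le x y : (0 < x)%N -> (x <= y)%N -> h4 y <= h4 x.
Proof.
move=> x0 xy; rewrite !h4E lef_pV2 ?posrE ?exprn_gt0 ?root4_gt0 //.
  by rewrite lerXn2r ?nnegrE ?root4_ge0 // root4_le.
exact: leq_trans xy.
Qed.

(** For [h] in $[0, 1)$, the inequality $1/(1-h) \le 1+3h$ holds exactly when $h \le 2/3$; this is
    the use made of the constant. *)
Lemma h4_le23 p : (1 < p)%N -> h4 p <= 2 / 3.
Proof.
move=> p1; apply: le_trans (h4_le _ p1) _ => //.
rewrite -(@ler_pXn2r _ 4) ?nnegrE ?h4_ge0 // ?divr_ge0 //.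
rewrite /h4 exprMn root4X4 exprVn -natrX; lra.
Qed.

Lemma sum_h4_le N : \sum_(1 <= x < N.+1) h4 x <= 4 * root4 N.
Proof.
elim: N => [|N IH]; first by rewrite big_geq // mulr_ge0 ?root4_ge0.
rewrite big_nat_recr //=; apply: le_trans (lerD IH (lexx _)) _.
rewrite h4E; set u := root4 N.+1; set v := root4 N.
have v0 : 0 <= v by apply: root4_ge0.
have u0 : 0 < u by apply: root4_gt0.
have vu : v <= u by apply: root4_le.
have E : u ^+ 4 = v ^+ 4 + 1 by rewrite !root4X4 -natr1.
have u3 : 0 < u ^+ 3 by rewrite exprn_gt0.
rewrite addrC -lerBrDr -[X in X <= _]mul1r ler_pdivrMr //.
(* The product equals $4u^3(u-v) - (u^4-v^4)$, and $u^4-v^4 = 1$. *)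
have : 0 <= (u - v) ^+ 2 * (3 * u ^+ 2 + 2 * u * v + v ^+ 2).
  by rewrite mulr_ge0 ?sqr_ge0 // !addr_ge0 ?mulr_ge0 ?sqr_ge0 // ltW.
by move: E => {IH}; clearbody u v; lra.
Qed.

Lemma sum_root4V_le N :
  \sum_(1 <= x < N.+1) (root4 x)^-1 <= 2 * root4 N ^+ 3.
Proof.
elim: N => [|N IH]; first by rewrite big_geq // mulr_ge0 ?exprn_ge0 ?root4_ge0.
rewrite big_nat_recr //=; apply: le_trans (lerD IH (lexx _)) _.
set u := root4 N.+1; set v := root4 N.
have v0 : 0 <= v by apply: root4_ge0.
have u0 : 0 < u by apply: root4_gt0.
have vu : v <= u by apply: root4_le.
have E : u ^+ 4 = v ^+ 4 + 1 by rewrite !root4X4 -natr1.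
rewrite addrC -lerBrDr -[X in X <= _]mul1r ler_pdivrMr //.
(* The product equals $2u(u^3-v^3) - (u^4-v^4)$. *)
have : 0 <= (u - v) * (u ^+ 3 + u ^+ 2 * v + v ^+ 2 * (u - v)).
  have uv : 0 <= u - v by rewrite subr_ge0.
  by rewrite mulr_ge0 // !addr_ge0 ?mulr_ge0 ?exprn_ge0 ?sqr_ge0 // ltW.
by move: E => {IH}; clearbody u v; lra.
Qed.

Lemma sum_multiples (g : nat -> R) d N : (0 < d)%N ->
  \sum_(1 <= x < N.+1 | (d %| x)%N) g x = \sum_(1 <= j < (N %/ d).+1) g (d * j)%N.
Proof.
move=> d0; elim: N => [|N IH]; first by rewrite div0n !big_geq.
rewrite big_mkcond big_nat_recr //= -big_mkcond IH divnS //.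
case: (boolP (d %| N.+1)%N) => dN; last by rewrite add0n addr0.
have E : (d * (N %/ d).+1 = N.+1)%N.
  by have := divnS N d0; rewrite dN add1n => <-; rewrite mulnC divnK.
by rewrite add1n [in RHS]big_nat_recr //= E.
Qed.

(** As [g] is nonincreasing, [d] times its value at a multiple of [d] is at most its sum over the
    [d] integers ending there. *)
Lemma sum_multiples_le (g : nat -> R) d N : (0 < d)%N ->
    (forall x, 0 <= g x) ->
    (forall x y, (0 < x)%N -> (x <= y)%N -> g y <= g x) ->
  d%:R * (\sum_(1 <= x < N.+1 | (d %| x)%N) g x) <= \sum_(1 <= x < N.+1) g x.
Proof.
move=> d0 g0 gle; rewrite sum_multiples //.
have /(le_trans _) : \sum_(1 <= x < (d * (N %/ d)).+1) g x <= \sum_(1 <= x < N.+1) g x.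
  rewrite [X in _ <= X](@big_cat_nat _ _ _ (d * (N %/ d)).+1) //=; last first.
    by rewrite ltnS mulnC leq_trunc_div.
  by rewrite lerDl sumr_ge0.
apply; elim: (N %/ d)%N => [|J IH]; first by rewrite muln0 !big_geq ?mulr0.
rewrite big_nat_recr //= mulrDr.
rewrite [X in _ <= X](@big_cat_nat _ _ _ (d * J).+1) //=; last first.
  by rewrite ltnS leq_mul2l leqnSn orbT.
apply: lerD IH _.
have -> : d%:R * g (d * J.+1)%N = \sum_((d * J).+1 <= x < (d * J.+1).+1) g (d * J.+1)%N.
  by rewrite sumr_const_nat subSS mulnS addnK mulr_natl.
rewrite !big_nat; apply: ler_sum => x /andP [x1 x2].
by apply: gle => //; apply: leq_trans x1.
Qed.

(** A truncation of the Euler product of $1/(1-p^{-3/4})$ over the primes in [ps]. *)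
Definition smooth_sum (ps : seq nat) (N : nat) : R :=
  \sum_(1 <= d < N.+1 | all (mem ps) (primes d)) h4 d.

Lemma smooth_sum_ge0 ps N : 0 <= smooth_sum ps N.
Proof. by apply: sumr_ge0 => d _; apply: h4_ge0. Qed.

Lemma smooth_sum_le ps N : all prime ps ->
  smooth_sum ps N <= expR (3 * \sum_(p <- ps) h4 p).
Proof.
elim: ps => [_|p ps IH /= /andP [pp /IH {}IH]].
  rewrite big_nil mulr0 expR0 /smooth_sum.
  case: N => [|N]; first by rewrite big_geq ?ler01.
  rewrite big_ltn_cond //= h4_1 big_nat_cond big1 ?addr0 // => d.
  move=> /andP [/andP [d1 _]] /=; case E: (primes d) => [|//] _.
  by move: d1; rewrite ltnNge; case: d E => [|[|d]] //= /eqP; rewrite primes_eq0.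
have p1 := prime_gt1 pp; have p0 := prime_gt0 pp.
(* Either p does not divide d, or d = p d' with d' again supported on p :: ps:
   this is the geometric series of the Euler factor at p in disguise. *)
have le1 : smooth_sum (p :: ps) N <= smooth_sum ps N + h4 p * smooth_sum (p :: ps) N.
  rewrite {1}/smooth_sum (bigID (fun d => (p %| d)%N)) /= addrC; apply: lerD.
    rewrite /smooth_sum big_mkcond [X in _ <= X]big_mkcond /=.
    rewrite !big_nat; apply: ler_sum => d /andP [d1 _].
    case: ifP => [/andP [dps pd]|_]; last by case: ifP => // _; rewrite h4_ge0.
    rewrite ifT //; apply/allP => q qd; have := allP dps q qd.
    rewrite /= inE => /orP [/eqP E|//]; move: qd pd.
    by rewrite E mem_primes => /and3P [_ _ ->].
  under eq_bigl => d do rewrite andbC.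
  rewrite big_mkcondr sum_multiples //= /smooth_sum big_mkcond mulr_sumr.
  rewrite [X in _ <= X](@big_cat_nat _ _ _ (N %/ p).+1) //=; last first.
    by rewrite ltnS leq_div.
  apply: ler_wpDr; first by apply: sumr_ge0 => d _; rewrite mulr_ge0 ?h4_ge0.
  rewrite [X in _ <= X]big_mkcond /= !big_nat; apply: ler_sum => d /andP [d1 _].
  case: ifP => [dps|_]; last by case: ifP => // _; rewrite mulr_ge0 ?h4_ge0.
  rewrite h4M ifT //; apply/allP => q qd; apply: (allP dps).
  by rewrite primesM // qd orbT.
have hp := h4_le23 p1.
(* The factor $1/(1-h)$ is then bounded by $1+3h$, hence by $e^{3h}$. *)
have : smooth_sum (p :: ps) N * (1 - h4 p) <= smooth_sum ps N.
  by rewrite mulrBr mulr1 lerBlDr [_ * h4 p]mulrC.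
rewrite -ler_pdivlMr; last by lra.
move/le_trans; apply; rewrite big_cons mulrDr expRD mulrC.
have hp0 := h4_ge0 p.
apply: ler_pM => //; rewrite ?invr_ge0 ?smooth_sum_ge0 //; first by lra.
apply: le_trans (expR_ge1Dx (3 * h4 p)); rewrite -[X in X <= _]mul1r ler_pdivrMr; last by lra.
by nra.
Qed.

(** The weight of [x] is one term of the sum of [root4 d] over the divisors [d] of [x] supported on
    [ps]. After exchanging the sums, the multiples of [d] carry at most a proportion $1/d$ of the
    sum of [g], and [root4 d / d] is [h4 d]. *)
Lemma part_sum_le (g : nat -> R) (ps : seq nat) N :
    (forall x, 0 <= g x) ->
    (forall x y, (0 < x)%N -> (x <= y)%N -> g y <= g x) ->
  \sum_(1 <= x < N.+1) root4 (x`_[pred p in ps]) * g x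
    <= smooth_sum ps N * \sum_(1 <= x < N.+1) g x.
Proof.
move=> g0 gle.
apply: (@le_trans _ _ (\sum_(1 <= x < N.+1)
   \sum_(1 <= d < N.+1 | all (mem ps) (primes d) && (d %| x)%N) root4 d * g x)).
  rewrite !big_nat; apply: ler_sum => x /andP [x1 xN].
  set d := (x`_ _)%N.
  have d1 : (0 < d)%N by rewrite part_gt0.
  have dx : (d %| x)%N by apply: dvdn_part.
  have dN : (d < N.+1)%N by apply: leq_ltn_trans xN; apply: dvdn_leq.
  have dps : all (mem ps) (primes d).
    by apply/allP => q; rewrite primes_part mem_filter => /andP [].
  rewrite big_mkcond (bigD1_seq d) /= ?mem_index_iota ?iota_uniq ?d1 //.
  rewrite dps dx /= lerDl; apply: sumr_ge0 => e _; case: ifP => // _.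
  by rewrite mulr_ge0 ?root4_ge0.
rewrite (exchange_big_dep_nat (fun d => all (mem ps) (primes d))) /=; last first.
  by move=> x d _ _ _ /andP [].
rewrite /smooth_sum mulr_suml [X in X <= _]big_mkcond [X in _ <= X]big_mkcond /=.
rewrite [X in X <= _]big_nat [X in _ <= X]big_nat.
apply: ler_sum => d /andP [d1 _]; case: ifP => // dps.
have dR : 0 < d%:R :> R by rewrite ltr0n.
rewrite -mulr_sumr /h4 -mulrA; apply: ler_wpM2l; first exact: root4_ge0.
rewrite mulrC ler_pdivlMr // mulrC.
rewrite dps /=.
exact: sum_multiples_le.
Qed.

End SmoothSums.

(** * Orders with a prescribed divisor *)

Section PrescribedDivisor.

Variable R : realType.
Local Open Scope ring_scope.

Local Notation root4 := (@root4 R).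
Local Notation h4 := (@h4 R).

(** There are at most [w] terms, each at most [h4 (w ^ 2)], that is $w^{-3/2} \le 1/w$. *)
Lemma sum_h4_rough_le (ps : seq nat) (y w : nat) :
    all (leq y.+1) ps -> (size ps <= w)%N -> (w ^ 2 <= y)%N ->
  \sum_(p <- ps) h4 p <= 1.
Proof.
move=> psy szps wy; case: (posnP w) => [w0|w0].
  by move: szps; rewrite w0 leqn0 size_eq0 => /eqP ->; rewrite big_nil ler01.
have wR : 0 < w%:R :> R by rewrite ltr0n.
have h4w : h4 (w ^ 2) <= w%:R^-1.
  rewrite /h4 natrX expr2 invfM mulrA ler_pdivrMr // mulVf ?gt_eqF //.
  by rewrite ler_pdivrMr // mul1r root4_sqr_le.
apply: (@le_trans _ _ (\sum_(p <- ps) w%:R^-1)).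
  rewrite big_seq [X in _ <= X]big_seq; apply: ler_sum => p /(allP psy) yp.
  apply: le_trans h4w; apply: h4_le; first by rewrite expn_gt0 w0.
  by apply: leq_trans wy _; apply: ltnW.
rewrite big_const_seq count_predT iter_addr_0 -[X in X <= _]mulr_natl.
by rewrite ler_pdivrMr // mul1r ler_nat.
Qed.

Lemma sum_ord_from1 (f : nat -> R) N :
  \sum_(l < N) f l.+1 = \sum_(1 <= x < N.+1) f x.
Proof. by rewrite big_add1 /= big_mkord. Qed.

(** The hockey-stick identity evaluates the sum as ['C(N + C, C.+1)]. The inequality is the step
    condition for ['C(N + C, C)] when each cycle has mean weight at most [C]. *)
Lemma sum_bin_le C N : (C * (\sum_(i < N) 'C(i + C, C)) <= N * 'C(N + C, C))%N.
Proof.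
have -> : (\sum_(i < N) 'C(i + C, C) = 'C(N + C, C.+1))%N.
  elim: N => [|N IH]; first by rewrite big_ord0 add0n bin_small.
  by rewrite big_ord_recr /= IH addSn binS.
have := mul_bin_left (N + C) C; rewrite addnK => <-.
by rewrite leq_mul2r leqnSn orbT.
Qed.

Lemma lcms_gt0 ls : all (leq 1) ls -> (0 < lcms ls)%N.
Proof. by elim: ls => //= l ls IH /andP [l0 /IH]; rewrite lcmn_gt0 l0. Qed.

Lemma part_lcms_le (pi : nat_pred) ls : all (leq 1) ls ->
  ((lcms ls)`_pi %| \prod_(l <- ls) l`_pi)%N.
Proof.
elim: ls => [|l ls IH] /=; first by rewrite big_nil partn1.
move=> /andP [l0 ls0]; rewrite big_cons partn_lcm ?lcms_gt0 //.
by rewrite dvdn_lcm dvdn_mulr //= dvdn_mull // IH.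
Qed.

Lemma prob_dvd_order_le (n m y w C : nat) : (0 < m)%N ->
    all (leq y.+1) (primes m) -> (size (primes m) <= w)%N -> (w ^ 2 <= y)%N ->
    expR 3 <= C%:R :> R ->
  unif_prob R [pred s : 'S_n | (m %| #[s]%g)%N] <= 'C(n + C, C)%:R / root4 m.
Proof.
move=> m0 my mw wy eC.
pose pi : nat_pred := [pred p in primes m].
(* Markov's inequality, with the mean of the product bounded by a binomial: the
   weights have average at most C on each [1 .. N]. *)
pose F N ls : R := (root4 m)^-1 * \prod_(l <- ls) root4 (l`_pi)%N * 'C(N + C, C)%:R.
have -> : 'C(n + C, C)%:R / root4 m = F n [::].
  by rewrite /F big_nil mulr1 mulrC.
have rm : 0 < root4 m by apply: root4_gt0.
have c0 ls : 0 <= (root4 m)^-1 * \prod_(l <- ls) root4 (l`_pi)%N.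
  by rewrite mulr_ge0 ?invr_ge0 ?prodr_ge0 ?ltW // => l _; apply: root4_ge0.
apply: (@unif_prob_order_le R n (dvdn m) F).
- move=> ls ls0 _ mls; rewrite /F add0n binn mulr1 ler_pdivlMl // mulr1.
  have -> : \prod_(l <- ls) root4 (l`_pi)%N = root4 (\prod_(l <- ls) l`_pi)%N.
    by elim: (ls) => [|l ls' IH]; rewrite ?big_nil ?root4_1 // !big_cons IH root4M.
  apply: root4_le; apply: dvdn_leq; first by rewrite prodn_gt0 // => l; apply: part_gt0.
  apply: dvdn_trans (part_lcms_le _ ls0).
  rewrite -[X in (X %| _)%N](@part_pnat_id pi) ?partn_dvd ?lcms_gt0 //.
  by rewrite /pnat m0; apply/allP.
- by move=> N ls; rewrite /F mulr_ge0.
move=> N ls N0 ls0 _; rewrite /F.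
set c := _ * \prod_(l <- ls) _.
have -> : \sum_(l < N) (root4 m)^-1 * (\prod_(i <- l.+1 :: ls) root4 (i`_pi)%N)
      * 'C(N - l.+1 + C, C)%:R
    = c * \sum_(1 <= x < N.+1) root4 (x`_pi)%N * 'C(N - x + C, C)%:R.
  rewrite mulr_sumr -(sum_ord_from1 (fun x => c * (root4 (x`_pi)%N * 'C(N - x + C, C)%:R))).
  by apply: eq_bigr => l _; rewrite big_cons /c; ring.
rewrite mulrCA; apply: ler_wpM2l; first exact: c0.
have := @part_sum_le R (fun x => 'C(N - x + C, C)%:R) (primes m) N.
move=> /= le1; apply: le_trans (le1 _ _) _ => {le1} //.
  move=> x x' _ xx'; rewrite ler_nat; apply: leq_bin2l.
  by rewrite leq_add2r leq_sub2l.
(* The values of [h4] at the primes of [m] sum to at most 1, whence the constant [expR 3]. *)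
have sC : smooth_sum R (primes m) N <= C%:R.
  apply: le_trans (smooth_sum_le _ _ _) _.
    by apply/allP => p; rewrite mem_primes => /and3P [].
  apply: le_trans eC; rewrite ler_expR -[X in _ <= X]mulr1 ler_pM2l //.
  exact: (sum_h4_rough_le my mw wy).
rewrite -(sum_ord_from1 (fun x => 'C(N - x + C, C)%:R)).
apply: (@le_trans _ _ (C%:R * \sum_(l < N) 'C(N - l.+1 + C, C)%:R)).
  by apply: ler_wpM2r => //; apply: sumr_ge0.
have -> : \sum_(l < N) 'C(N - l.+1 + C, C)%:R = (\sum_(i < N) 'C(i + C, C))%:R :> R.
  rewrite natr_sum (reindex_inj rev_ord_inj) /=; apply: eq_bigr => i _.
  by rewrite (_ : (N - (N - i.+1).+1 = i)%N) //; have := ltn_ord i; lia.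
by rewrite -!natrM ler_nat sum_bin_le.
Qed.

End PrescribedDivisor.

(** * Growth of the rough part of the order *)

Lemma exp2_size_primes d : 0 < d -> 2 ^ size (primes d) <= d.
Proof.
move=> d0; rewrite {2}[d](prod_prime_decomp d0) /primes size_map.
have : all (fun f => 1 < f.1 ^ f.2) (prime_decomp d).
  apply/allP => -[p e] /mem_prime_decomp [pp e0 _] /=.
  by apply: leq_trans (prime_gt1 pp) _; rewrite -{1}[p]expn1 leq_pexp2l // prime_gt0.
elim: (prime_decomp d) => [|f s IH] /=; first by rewrite big_nil.
by move=> /andP [f1 /IH s1]; rewrite big_cons expnS leq_mul.
Qed.

(** Existence of a divisor to which [prob_dvd_order_le] applies, once [w ^ 2 <= y]. *)
Definition rich (b y w L : nat) : bool :=
  has (fun d => [&& b <= d, all (leq y.+1) (primes d) & size (primes d) <= w])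
    (divisors L).

Lemma rich_dvd b y w L L' : 0 < L' -> L %| L' -> rich b y w L -> rich b y w L'.
Proof.
move=> L0 LL' /hasP [d]; rewrite -dvdn_divisors ?(dvdn_gt0 L0) // => dL rd.
by apply/hasP; exists d => //; rewrite -dvdn_divisors // (dvdn_trans dL).
Qed.

Lemma lcms_le n ls : all (leq 1) ls -> sumn ls <= n -> lcms ls <= n ^ size ls.
Proof.
elim: ls => //= l ls IH /andP [l0 ls0] ln.
rewrite expnS; apply: leq_trans (_ : l * lcms ls <= _).
  by rewrite dvdn_leq ?muln_gt0 ?l0 ?lcms_gt0 // dvdn_lcm dvdn_mulr ?dvdn_mull.
by rewrite leq_mul ?IH //; lia.
Qed.

Section RoughPart.

Variables (n K y w : nat).
Hypothesis nKw : n ^ K < 2 ^ w.+1.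

Definition rough_part (ls : seq nat) := (lcms ls)`_[pred p | y < p].

(* The primes that do not count as new after exposing [ls]: those at most [y],
   and those dividing one of the lengths. *)
Definition seen_primes (ls : seq nat) :=
  [seq p <- iota 0 y.+1 | prime p] ++ [seq p <- primes (lcms ls) | y < p].

Lemma seen_primes_prime ls : all prime (seen_primes ls).
Proof.
apply/allP => p; rewrite mem_cat !mem_filter mem_primes.
by case/orP => [/andP []|/and4P []].
Qed.

Lemma rough_part_gt0 ls : 0 < rough_part ls. Proof. exact: part_gt0. Qed.

Lemma primes_rough_part ls :
  primes (rough_part ls) = [seq p <- primes (lcms ls) | y < p].
Proof. by rewrite primes_part. Qed.

(** The lcm of at most [K] lengths is at most [n ^ K], too small to have [w.+1] distinct primes. *)
Lemma size_primes_rough_part ls : all (leq 1) ls -> sumn ls <= n -> 0 < n ->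
  size ls <= K -> size (primes (rough_part ls)) <= w.
Proof.
move=> ls0 lsn n0 lsK; rewrite -ltnS -(ltn_exp2l _ _ (isT : 1 < 2)).
apply: leq_ltn_trans nKw; apply: leq_trans (exp2_size_primes (rough_part_gt0 _)) _.
apply: leq_trans (dvdn_leq (lcms_gt0 ls0) (dvdn_part _ _)) _.
by apply: leq_trans (lcms_le ls0 lsn) _; rewrite leq_pexp2l.
Qed.

(** The rough part is itself a candidate divisor, and only its size can fail. *)
Lemma not_rich_rough_part b ls : all (leq 1) ls -> sumn ls <= n -> 0 < n ->
  size ls <= K -> ~~ rich b y w (lcms ls) -> rough_part ls < b.
Proof.
move=> ls0 lsn n0 lsK; apply: contraNltn => bR; apply/hasP.
exists (rough_part ls); first by rewrite -dvdn_divisors ?lcms_gt0 ?dvdn_part.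
rewrite bR size_primes_rough_part // andbT primes_rough_part /=.
by apply/allP => p; rewrite mem_filter => /andP [].
Qed.

(** The part of [x] outside the seen primes is coprime to the old rough part, and both divide the
    new one. *)
Lemma rough_part_cons x ls : 0 < x -> all (leq 1) ls ->
  rough_part ls * x <= rough_part (x :: ls) * x`_[pred p in seen_primes ls].
Proof.
move=> x0 ls0; set pi : nat_pred := [pred p in seen_primes ls].
have L0 := lcms_gt0 ls0.
have L'0 : 0 < lcms (x :: ls) by apply: lcms_gt0; rewrite /= x0.
rewrite -{1}(partnC pi x0) [x`_pi * _]mulnC mulnA leq_mul2r; apply/orP; right.
apply: dvdn_leq; first exact: part_gt0.
rewrite Gauss_dvd; last first.
  apply: (@pnat_coprime pi); last exact: part_pnat.
  rewrite /pnat part_gt0 /=; apply/allP => p; rewrite primes_rough_part => pR.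
  by rewrite !inE mem_cat pR orbT.
rewrite partn_dvd ?dvdn_lcmr //=.
rewrite -[X in X %| _](@part_pnat_id [pred p | y < p]).
  by rewrite partn_dvd // (dvdn_trans (dvdn_part _ _)) ?dvdn_lcml.
rewrite /pnat part_gt0 /=; apply/allP => p; rewrite primes_part mem_filter.
rewrite !inE mem_cat => /andP []; rewrite negb_or !mem_filter => /andP [py _].
rewrite mem_primes => /and3P [pp _ _]; move: py.
by rewrite pp andTb mem_iota andTb add0n ltnS -ltnNge.
Qed.

End RoughPart.

(** * Probability that the first [K] cycles yield no large rough divisor *)

Section FewCycles.

Variable R : realType.
Local Open Scope ring_scope.

Local Notation root4 := (@root4 R).
Local Notation h4 := (@h4 R).

Variables (n b y w K X : nat) (lambda : R).
Hypotheses (nKw : (n ^ K < 2 ^ w.+1)%N) (wy : (w ^ 2 <= y)%N).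
Hypothesis X0 : (0 < X)%N.
(* The term i = 0 of the sum is 0. *)
Hypothesis lambdaE : 1 + \sum_(i < n) i%:R^-1 <= lambda.

Let n_gt0 N (ls : seq nat) : (0 < N)%N -> (N + sumn ls = n)%N -> (0 < n)%N.
Proof. by lia. Qed.

(** In the exponent, [4 * root4 y] accounts for the primes up to [y] and 1 for the larger seen
    primes. With at least [X] points left, [theta] bounds the mean factor by which one cycle changes
    the inverse of [root4 (rough_part y ls)]. *)
Let E : R := expR (3 * (4 * root4 y + 1)).
Let theta : R := 2 * E / root4 X.

Lemma smooth_sum_seen_le N ls :
    all (leq 1) ls -> (sumn ls <= n)%N -> (0 < n)%N -> (size ls <= K)%N ->
  smooth_sum R (seen_primes y ls) N <= E.
Proof.
move=> ls0 lsn n0 lsK.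
apply: le_trans (smooth_sum_le _ _ (seen_primes_prime _ _)) _.
rewrite ler_expR ler_pM2l // big_cat /=; apply: lerD; last first.
  apply: (@sum_h4_rough_le _ _ y w) => //.
    by apply/allP => p; rewrite mem_filter => /andP [].
  by rewrite -primes_rough_part; exact: (size_primes_rough_part _ nKw).
apply: le_trans (sum_h4_le _ _); rewrite big_filter big_mkcond /=.
rewrite /index_iota subSS subn0; apply: ler_sum => p _.
by case: ifP => // _; apply: h4_ge0.
Qed.

(* [U] accounts for the event that the K-th exposed cycle leaves the rough part
   below [b], and [V] for the event that fewer than [X] points remain before K
   cycles are exposed. *)
Let U ls : R := root4 b / root4 (rough_part y ls) * theta ^+ (K - size ls).
Let V N k : R := X%:R / N%:R * lambda ^+ (K - k).
(** Richness persists under further exposure, so it gives 0. Otherwise exposure stops at [K] cycles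
    or below [X] points, with the trivial bound 1. *)
Let F N ls : R :=
  if rich b y w (lcms ls) then 0 else
  if (N < X)%N || (K <= size ls)%N then 1 else U ls + V N (size ls).

Let E_gt0 : 0 < E. Proof. exact: expR_gt0. Qed.
Let theta_ge0 : 0 <= theta.
Proof. by rewrite divr_ge0 ?root4_ge0 // mulr_ge0 // ltW. Qed.
Let lambda_ge1 : 1 <= lambda.
Proof. by apply: le_trans lambdaE; rewrite lerDl sumr_ge0. Qed.
Let U_ge0 ls : 0 <= U ls.
Proof. by apply: mulr_ge0; [rewrite divr_ge0 ?root4_ge0 | apply: exprn_ge0]. Qed.
Let V_ge0 N k : 0 <= V N k.
Proof. by rewrite mulr_ge0 ?divr_ge0 // exprn_ge0 // (le_trans ler01). Qed.
Let F_ge0 N ls : 0 <= F N ls.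
Proof. by rewrite /F; case: ifP => // _; case: ifP => // _; rewrite addr_ge0. Qed.

Let sum_U_le N ls : (X <= N)%N -> all (leq 1) ls -> (N + sumn ls = n)%N ->
    (size ls < K)%N ->
  \sum_(l < N) U (l.+1 :: ls) <= N%:R * U ls.
Proof.
move=> XN ls0 Nn lsK; have N0 := leq_trans X0 XN; have n0 := n_gt0 N0 Nn.
set pi : nat_pred := [pred p in seen_primes y ls].
pose c : R := root4 b / root4 (rough_part y ls) * theta ^+ (K - (size ls).+1).
have c0 : 0 <= c.
  by apply: mulr_ge0; [rewrite divr_ge0 ?root4_ge0 | apply: exprn_ge0].
have leU x : (0 < x)%N -> U (x :: ls) <= c * (root4 (x`_pi)%N * (root4 x)^-1).
  move=> x0; rewrite /U /c /= -!mulrA; apply: ler_wpM2l; first exact: root4_ge0.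
  rewrite [X in X <= _]mulrC [X in _ <= X]mulrCA; apply: ler_wpM2l; first exact: exprn_ge0.
  have := rough_part_cons y x0 ls0; rewrite -/pi => /(root4_le R).
  rewrite !root4M => le.
  have r1 : 0 < root4 (rough_part y ls) by rewrite root4_gt0 ?rough_part_gt0.
  have r2 : 0 < root4 (rough_part y (x :: ls)) by rewrite root4_gt0 ?rough_part_gt0.
  have r3 : 0 < root4 x by apply: root4_gt0.
  rewrite mulrA [_^-1 * root4 _]mulrC -mulrA -invfM ler_pdivlMr ?mulr_gt0 //.
  by rewrite mulrC ler_pdivrMr // [X in _ <= X]mulrC.
apply: (@le_trans _ _ (\sum_(1 <= x < N.+1) c * (root4 (x`_pi)%N * (root4 x)^-1))).
  rewrite (sum_ord_from1 (fun x => U (x :: ls))) big_nat [X in _ <= X]big_nat.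
  by apply: ler_sum => x /andP [x0 _]; apply: leU.
rewrite -mulr_sumr.
have := @part_sum_le R (fun x => (root4 x)^-1) (seen_primes y ls) N.
move=> /= le1; apply: (le_trans (ler_wpM2l c0 (le1 _ _))) => {le1}.
- by move=> x; rewrite invr_ge0 root4_ge0.
- move=> x x' x0 xx'; rewrite lef_pV2 ?posrE ?root4_gt0 ?root4_le //.
  exact: leq_trans xx'.
have le2 := ler_pM (smooth_sum_ge0 R (seen_primes y ls) N) _
  (smooth_sum_seen_le N ls0 _ n0 (ltnW lsK)) (sum_root4V_le R N).
apply: (le_trans (ler_wpM2l c0 (le2 _ _))) => {le2}.
- by apply: sumr_ge0 => x _; rewrite invr_ge0 root4_ge0.
- lia.
(* It remains to see that $2EN^{3/4} \le N\theta$, which is where $N \ge X$ enters. *)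
have -> : U ls = c * theta by rewrite /U /c -[RHS]mulrA -exprSr subnSK.
rewrite [X in _ <= X]mulrCA; apply: ler_wpM2l => //.
have rX : 0 < root4 X by apply: root4_gt0.
rewrite /theta [X in _ <= X]mulrA ler_pdivlMr // -(root4X4 R N).
have := root4_le R XN; have := root4_ge0 R N.
set u := root4 N; set v := root4 X => u0 vu.
have : 0 <= (u - v) * (u ^+ 3 * E).
  by rewrite mulr_ge0 ?subr_ge0 // mulr_ge0 ?exprn_ge0 // ltW.
by clearbody u v E; lra.
Qed.

Let sum_V_le N k : (0 < N)%N -> (N <= n)%N -> (k < K)%N ->
  \sum_(l < N) (if (N - l.+1 < X)%N then 1 else V (N - l.+1) k.+1) <= N%:R * V N k.
Proof.
move=> N0 Nn kK.
(* Now [i] counts the points left. The values below [X] contribute at most [X], the others at most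
   [X * a * (lambda - 1)]; since [a >= 1], the total is at most [X * a * lambda]. *)
rewrite (reindex_inj rev_ord_inj) /=.
set a := lambda ^+ (K - k.+1).
have a1 : 1 <= a by apply: exprn_ege1.
have XR : 0 < X%:R :> R by rewrite ltr0n.
apply: (@le_trans _ _ (\sum_(i < N) ((i < X)%N%:R + X%:R * a * i%:R^-1))).
  apply: ler_sum => i _.
  have -> : (N - (N - i.+1).+1 = i)%N by have := ltn_ord i; lia.
  case: ifP => iX /=.
    by rewrite lerDl mulr_ge0 ?mulr_ge0 ?invr_ge0 // (le_trans ler01).
  by rewrite add0r /V -/a mulrAC.
rewrite big_split /= -mulr_sumr.
have -> : N%:R * V N k = X%:R * (a * lambda).
  rewrite /V /a -exprSr -subSn // subSS [LHS]mulrA [N%:R * _]mulrC divfK //.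
  by rewrite pnatr_eq0 -lt0n.
have le1 : \sum_(i < N) (i < X)%N%:R <= X%:R :> R.
  rewrite -natr_sum ler_nat (_ : (\sum_(i < N) (i < X) = minn N X)%N) ?geq_minr //.
  by elim: {N0 Nn} N => [|N IH]; rewrite ?big_ord0 ?min0n // big_ord_recr /= IH; lia.
have le2 : \sum_(i < N) i%:R^-1 <= lambda - 1 :> R.
  rewrite lerBrDl; apply: le_trans lambdaE; rewrite lerD2l.
  rewrite -(big_mkord xpredT (fun i => i%:R^-1)) -(big_mkord xpredT (fun i => i%:R^-1)).
  rewrite [X in _ <= X](@big_cat_nat _ _ _ N) //= lerDl; apply: sumr_ge0 => i _.
  by rewrite invr_ge0.
apply: le_trans (lerD le1 (ler_wpM2l _ le2)) _.
  by rewrite mulr_ge0 // (le_trans ler01).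
rewrite -mulrA -[X in X + _ <= _]mulr1 -mulrDr ler_pM2l // mulrBr mulr1.
lra.
Qed.

Lemma prob_not_rich_le : (X <= n)%N -> (0 < K)%N ->
  unif_prob R [pred s : 'S_n | ~~ rich b y w #[s]%g]
    <= root4 b * theta ^+ K + X%:R / n%:R * lambda ^+ K.
Proof.
move=> Xn K0.
have -> : root4 b * theta ^+ K + X%:R / n%:R * lambda ^+ K = U [::] + V n 0.
  by rewrite /U /V /rough_part /= partn1 root4_1 divr1 subn0.
apply: le_trans (_ : F n [::] <= _); last first.
  rewrite /F; case: ifP => _; first by rewrite addr_ge0.
  by rewrite ltnNge Xn leqNgt K0.
apply: (@unif_prob_order_le R n (fun L => ~~ rich b y w L) F) => //.
  by move=> ls _ _ /negbTE nr; rewrite /F nr X0.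
move=> N ls N0 ls0 Nn; have n0 := n_gt0 N0 Nn.
have lsn l : (l < N)%N -> all (leq 1) (l.+1 :: ls) && (sumn (l.+1 :: ls) <= n)%N.
  by move=> lN; rewrite /= ls0 /=; lia.
case: (boolP (rich b y w (lcms ls))) => rls.
  rewrite /F rls mulr0 big1 // => l _; rewrite ifT //.
  have /andP [l0 _] := lsn l (ltn_ord l).
  by apply: rich_dvd rls; [exact: lcms_gt0 | rewrite /= dvdn_lcmr].
case: (boolP ((N < X)%N || (K <= size ls)%N)) => NX.
  rewrite {2}/F (negbTE rls) NX mulr1 -[X in _ <= X%:R](card_ord N) -sumr_const.
  apply: ler_sum => l _; rewrite /F; case: ifP => // _; rewrite ifT //=.
  by case/orP: NX => NX; apply/orP; [left|right]; lia.
move: NX; rewrite negb_or -leqNgt -ltnNge => /andP [XN lsK].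
rewrite {2}/F (negbTE rls) ltnNge XN leqNgt lsK /= mulrDr.
have Nn' : (N <= n)%N by lia.
apply: le_trans (lerD (sum_U_le XN ls0 Nn lsK) (sum_V_le N0 Nn' lsK)).
rewrite -big_split /=; apply: ler_sum => l _.
have /andP [l0 l1] := lsn l (ltn_ord l).
rewrite /F; case: ifP => rl; first by case: ifP => _; rewrite addr_ge0.
case: ifP => [|/negbT]; last by rewrite negb_or => /andP [/negbTE -> _].
case: ifP => [_ _|_ /= lsK']; first by rewrite lerDr.
(* The cycle just exposed is the [K]-th: the power of [theta] is 1, and the rough part is below [b],
   so [U] alone reaches 1. *)
apply: ler_wpDr => //; rewrite /U /=.
have -> : (K - (size ls).+1 = 0)%N by lia.
rewrite expr0 mulr1 ler_pdivlMr ?root4_gt0 ?rough_part_gt0 // mul1r root4_le //.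
apply: ltnW; apply: (not_rich_rough_part (y := y) nKw l0 l1 n0 _ (negbT rl)).
exact: lsK.
Qed.

End FewCycles.

(** * Asymptotics *)

Lemma bin_leq_expn n k : 'C(n, k) <= n ^ k.
Proof.
apply: (@leq_trans (n ^_ k)).
  by rewrite -bin_ffact leq_pmulr // fact_gt0.
elim: k => // k IH; rewrite ffactnSr expnSr leq_mul // leq_subr //.
Qed.

Section Asymptotics.

Variable R : realType.
Local Open Scope classical_set_scope.
Local Open Scope ring_scope.

(** Absorbs every lower-order term of the exponents. With [s] the square root, $s \ge 2$ gives
    $s^2-2 \ge s^2/2$, and $\eta s \ge 4c$ finishes; [s0] ensures both. *)
Lemma near_sqrt_le_ln (c eta : R) : 0 <= c -> 0 < eta ->
  \forall n \near \oo, c * (1 + Num.sqrt (2 + ln n%:R)) <= eta * ln n%:R.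
Proof.
move=> c0 eta0; pose s0 := 2 + 4 * c / eta.
have s02 : 2 <= s0 by rewrite lerDl divr_ge0 ?mulr_ge0 // ltW.
near=> n.
have nexp : expR (s0 ^+ 2) <= n%:R by near: n; apply: nbhs_infty_ger.
have Ts : s0 ^+ 2 <= ln n%:R.
  by rewrite -[s0 ^+ 2]expRK ler_ln ?posrE ?expR_gt0 // (lt_le_trans (expR_gt0 _) nexp).
set T := ln n%:R in Ts *; set s := Num.sqrt (2 + T).
have T0 : 0 <= 2 + T by apply: addr_ge0 => //; apply: le_trans Ts; apply: sqr_ge0.
have s2 : s ^+ 2 = 2 + T by rewrite sqr_sqrtr.
have sge : s0 <= s.
  rewrite -(@ler_pXn2r _ 2) ?nnegrE ?sqrtr_ge0 //; last by apply: le_trans s02.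
  by rewrite s2; apply: le_trans Ts _; rewrite lerDr.
have cs : 4 * c <= eta * s.
  have : 4 * c / eta <= s by apply: le_trans sge; rewrite /s0 lerDr.
  by rewrite ler_pdivrMr // [s * _]mulrC.
have s2' : 2 <= s by apply: le_trans sge.
have -> : T = s ^+ 2 - 2 by rewrite s2 addrC addKr.
clearbody s; clear -c0 eta0 cs s2'.
have h1 : 0 <= s * (eta * s - 4 * c) by rewrite mulr_ge0 ?subr_ge0 //; lra.
have h2 : 0 <= eta * ((s - 2) * (s + 2)) by rewrite !mulr_ge0 ?subr_ge0 //; lra.
have h3 : 0 <= c * (s - 1) by rewrite mulr_ge0 //; lra.
nra.
Unshelve. all: by end_near. Qed.

(** The increments are compared through $\ln(1-1/(n+1)) \le -1/(n+1)$. *)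
Lemma sum_inv_le_ln n : (0 < n)%N -> \sum_(i < n.+1) i%:R^-1 <= 1 + ln n%:R :> R.
Proof.
elim: n => // n IH _; rewrite big_ord_recr /=.
case: (posnP n) => [->|n0].
  by rewrite big_ord1 invr0 add0r invr1 ln1 addr0.
apply: le_trans (lerD (IH n0) (lexx _)) _; rewrite -addrA lerD2l.
have nR : 0 < n%:R :> R by rewrite ltr0n.
have n1R : 0 < n.+1%:R :> R by rewrite ltr0n.
have := @le_ln1Dx R (- n.+1%:R^-1).
have -> : 1 + - n.+1%:R^-1 = n%:R / n.+1%:R :> R.
  by rewrite -[n%:R](addrK 1) natr1 mulrBl divff ?lt0r_neq0 // mul1r.
rewrite ln_div ?posrE // => le.
have : -1 < - n.+1%:R^-1 :> R by rewrite ltrN2 invf_lt1 // ltr1n.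
by move/le => le1; rewrite -lerBrDr; move: le1; rewrite lerBlDr addrC.
Qed.

Lemma powR_natE n (a : R) : (0 < n)%N -> n%:R `^ a = expR (a * ln n%:R).
Proof. by move=> n0; rewrite /powR pnatr_eq0 gtn_eqF. Qed.

Lemma expR_ln_nat n : (0 < n)%N -> expR (ln n%:R) = n%:R :> R.
Proof. by move=> n0; rewrite lnK // posrE ltr0n. Qed.

Lemma near_prob_not_rich_le (B : nat) (delta : R) : 0 < delta -> delta <= 2^-1 ->
  \forall n \near \oo, exists w,
    unif_prob R [pred s : 'S_n | ~~ rich (n ^ (4 * B)) (w ^ 2) w #[s]%g] + n%:R^-1
      <= n%:R `^ (-1 + 2 * delta).
Proof.
move=> d0 d2.
(* The main factor of [theta ^+ K] is then at most $n^{-(B+2)}$: it pays $n^B$ for [root4 b] and $n$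
   for the lower-order terms, leaving $1/n$. *)
have [K KB] : exists K : nat, 4 * (B%:R + 2) <= K%:R * delta.
  exists (Num.truncn (4 * (B%:R + 2) / delta)).+1.
  rewrite -ler_pdivrMr //; apply: ltW.
  have q0 : 0 <= 4 * (B%:R + 2) / delta.
    by rewrite divr_ge0 ?(ltW d0) // mulr_ge0 // addr_ge0.
  by have /andP [] := truncn_itv q0.
have K0 : (0 < K)%N.
  rewrite lt0n; apply: contraTneq KB => ->; rewrite mul0r -ltNge.
  by rewrite mulr_gt0 // ltr_wpDl.
have ln2 : 0 < ln 2 :> R by rewrite ln_gt0 // ltr1n.
have half0 : 0 < 2^-1 :> R by rewrite invr_gt0.
(* [c1] collects the lower-order terms of [theta ^+ K]: with [y = w ^ 2] and [w] of order $\ln n$,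
   [root4 y] is of order $\sqrt{\ln n}$. [c2] covers [lambda ^+ K] and a factor 4. *)
pose c1 := K%:R * (ln 2 + 3 + 12 * Num.sqrt (K%:R / ln 2)) : R.
pose c2 := K%:R * 2 + ln 4 : R.
have c1_0 : 0 <= c1.
  by rewrite mulr_ge0 // !addr_ge0 ?mulr_ge0 ?sqrtr_ge0 // ltW.
have c2_0 : 0 <= c2 by rewrite addr_ge0 ?mulr_ge0 // ln_ge0 // ler1n.
near=> n.
have n1 : (1 < n)%N by near: n; apply: nbhs_infty_ge.
have n0 : (0 < n)%N by apply: ltnW.
have nR : 0 < n%:R :> R by rewrite ltr0n.
have h1 : c1 * (1 + Num.sqrt (2 + ln n%:R)) <= 1 * ln n%:R.
  by near: n; apply: (near_sqrt_le_ln c1_0 ltr01).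
have h2 : c2 * (1 + Num.sqrt (2 + ln n%:R)) <= delta * ln n%:R.
  by near: n; apply: (near_sqrt_le_ln c2_0 d0).
have h3 : ln 2 * (1 + Num.sqrt (2 + ln n%:R)) <= 2^-1 * ln n%:R :> R.
  by near: n; apply: (near_sqrt_le_ln (ltW ln2) half0).
set T : R := ln n%:R in h1 h2 h3 *; pose s := Num.sqrt (2 + T).
rewrite -/s in h1 h2 h3.
have T0 : 0 <= T by rewrite ln_ge0 // ler1n.
have s0 : 0 <= s by apply: sqrtr_ge0.
pose w := trunc_log 2 (n ^ K).
exists w.
have nK0 : (0 < n ^ K)%N by rewrite expn_gt0 n0.
have /andP [w1 w2] := trunc_log_bounds (isT : (1 < 2)%N) nK0.
have wT : w%:R <= K%:R / ln 2 * T.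
  rewrite mulrAC ler_pdivlMr // /T -!ln_powR !powR_mulrn // -!natrX.
  by rewrite ler_ln ?posrE ?ltr0n ?expn_gt0 ?n0 // ler_nat.
have sw : root4 R (w ^ 2) <= Num.sqrt (K%:R / ln 2) * s.
  rewrite /root4 natrX sqrtr_sqr ger0_norm // /s -sqrtrM ?divr_ge0 // ?(ltW ln2) //.
  apply: ler_wsqrtr; apply: le_trans wT _.
  by rewrite ler_wpM2l ?divr_ge0 ?(ltW ln2) // lerDr.
pose X := (Num.truncn (expR (delta * T))).+1.
have [X1 X2] : expR (delta * T) <= X%:R /\ X%:R <= 2 * expR (delta * T).
  have /andP [t1 t2] := truncn_itv (ltW (expR_gt0 (delta * T))).
  split; first exact: ltW.
  have : 1 <= expR (delta * T) by rewrite -expR0 ler_expR mulr_ge0 // ltW.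
  by rewrite /X -natr1; lra.
have Xn : (X <= n)%N.
  rewrite -(@ler_nat R); apply: le_trans X2 _.
  rewrite -(@expR_ln_nat n) // -{1}[2]lnK ?posrE // -expRD ler_expR -/T.
  have : delta * T <= 2^-1 * T by apply: ler_wpM2r.
  have : ln 2 <= ln 2 * (1 + s) :> R by rewrite ler_pMr // lerDl.
  by lra.
have lam : 1 + \sum_(i < n) i%:R^-1 <= 2 + T.
  have := sum_inv_le_ln n0; rewrite big_ord_recr /= => le.
  have := invr_ge0 (n%:R : R); rewrite ler0n => i0.
  by rewrite -/T in le; lra.
have wy : (w ^ 2 <= w ^ 2)%N by [].
have X0 : (0 < X)%N by [].
have := @prob_not_rich_le R n (n ^ (4 * B)) (w ^ 2) w K X (2 + T) w2 wy X0 lam Xn K0.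
set P := unif_prob _ _ => leP.
have le1 : root4 R (n ^ (4 * B)) *
    (2 * expR (3 * (4 * root4 R (w ^ 2) + 1)) / root4 R X) ^+ K <= n%:R^-1.
  rewrite mulnC expnM root4_exp4.
  have rX : expR (delta * T / 4) <= root4 R X.
    rewrite le_root4 ?expR_ge0 // -expRM_natr.
    by rewrite -mulrA mulVf ?mulr1.
  have rX0 : 0 < root4 R X by apply: root4_gt0.
  pose e := ln 2 + 3 * (4 * root4 R (w ^ 2) + 1) - delta * T / 4.
  have th : 2 * expR (3 * (4 * root4 R (w ^ 2) + 1)) / root4 R X <= expR e.
    rewrite /e expRB expRD lnK ?posrE //; apply: ler_wpM2l.
      by rewrite mulr_ge0 ?expR_ge0.
    by rewrite lef_pV2 ?posrE ?expR_gt0.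
  apply: (@le_trans _ _ (n%:R ^+ B * expR e ^+ K)).
    rewrite natrX; apply: ler_wpM2l; first exact: exprn_ge0.
    apply: lerXn2r => //; rewrite nnegrE ?expR_ge0 //.
    by rewrite divr_ge0 ?root4_ge0 // mulr_ge0 ?expR_ge0.
  rewrite -(@expR_ln_nat n) // -expRM_natl -expRM_natl -expRN -expRD ler_expR -/T.
  have hK : K%:R * e <= c1 * (1 + s) - K%:R * delta * T / 4.
    rewrite /e /c1.
    have k0 : 0 <= K%:R * Num.sqrt (K%:R / ln 2) :> R by rewrite mulr_ge0 ?sqrtr_ge0.
    have := ler_wpM2l (ler0n R K) sw.
    set q := Num.sqrt _ in k0 *; set r := root4 _ _ => h.
    have h' : 0 <= K%:R * (ln 2 + 3) * s by rewrite !mulr_ge0 ?addr_ge0 ?(ltW ln2).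
    lra.
  have : 4 * (B%:R + 2) * T <= K%:R * delta * T by apply: ler_wpM2r.
  lra.
have le2 : X%:R / n%:R * (2 + T) ^+ K <= 2 * expR (delta * T) / n%:R * expR (K%:R * (2 * s)).
  have T2 : 2 + T <= expR (2 * s).
    rewrite mulrC expRM_natr -[X in X <= _]sqr_sqrtr; last by rewrite addr_ge0.
    rewrite -/s lerXn2r ?nnegrE ?expR_ge0 //.
    by apply: le_trans (expR_ge1Dx s); rewrite lerDr.
  rewrite expRM_natl; apply: ler_pM.
  - by rewrite divr_ge0.
  - by rewrite exprn_ge0 // addr_ge0.
  - by rewrite ler_pM2r // invr_gt0.
  by rewrite lerXn2r ?nnegrE ?expR_ge0 // addr_ge0.
have nE : n%:R^-1 = expR (- T) :> R by rewrite expRN expR_ln_nat.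
apply: le_trans (lerD (le_trans leP (lerD le1 le2)) (lexx _)) _.
rewrite powR_natE // nE -/T.
set u := expR (delta * T); set v := expR (K%:R * (2 * s)).
have u1 : 1 <= u by rewrite -expR0 ler_expR mulr_ge0 // ltW.
have v1 : 1 <= v by rewrite -expR0 ler_expR mulr_ge0 // mulr_ge0.
have -> : expR ((-1 + 2 * delta) * T) = expR (- T) * (u * u).
  by rewrite /u -!expRD; congr expR; ring.
(* Up to the factor [z], the goal is $2+2uv \le u^2$; it follows from $uv \ge 1$ and $4v \le u$. *)
have v4 : 4 * v <= u.
  rewrite -[4]lnK ?posrE // /v /u -expRD ler_expR.
  apply: le_trans h2; rewrite /c2.
  have : 0 <= ln 4 * s by rewrite mulr_ge0 // ln_ge0 // ler1n.
  have : 0 <= K%:R :> R by [].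
  lra.
have e0 : 0 <= expR (- T) by apply: expR_ge0.
have uv : 1 <= u * v by rewrite -[1]mulr1 ler_pM.
have uu : 4 * (u * v) <= u * u.
  by rewrite mulrCA ler_wpM2l // (le_trans ler01).
set z := expR (- T) in e0 *; clearbody u v z.
have : z * (2 + 2 * (u * v)) <= z * (u * u) by apply: ler_wpM2l => //; lra.
lra.
Unshelve. all: by end_near. Qed.

Lemma unif_prob_ge0 (T : finType) (E : pred T) : 0 <= unif_prob R E.
Proof. by rewrite divr_ge0. Qed.

Lemma unif_prob_le (T : finType) (E1 E2 : pred T) :
  (forall x, E1 x -> E2 x) -> unif_prob R E1 <= unif_prob R E2.
Proof.
move=> E12; rewrite ler_wpM2r ?invr_ge0 // ler_nat.
by apply: subset_leq_card; apply/fintype.subsetP => x; apply: E12.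
Qed.

(** The binomial is at most $(2n)^C \le n^{C+1}$, while [root4 d] is at least $n^{C+101}$; hence the
    exponent [4 * (C + 101)]. *)
Lemma near_rich_prob_le (C : nat) : expR 3 <= C%:R :> R ->
  \forall n \near \oo, forall w m, (0 < m)%N ->
    rich (n ^ (4 * (C + 101))) (w ^ 2) w m -> prob_ord_eq R n m <= n%:R ^- 100.
Proof.
move=> eC; near=> n => w m m0.
have nC : (C.+1 <= n)%N by near: n; apply: nbhs_infty_ge.
have n2C : (2 ^ C <= n)%N by near: n; apply: nbhs_infty_ge.
have n0 : (0 < n)%N by apply: leq_trans nC.
have nR : 0 < n%:R :> R by rewrite ltr0n.
move=> /hasP [d]; rewrite -dvdn_divisors // => dm /and3P [bd dy dw].
have d0 : (0 < d)%N by apply: dvdn_gt0 dm.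
apply: le_trans (_ : unif_prob R [pred s : 'S_n | (d %| #[s]%g)%N] <= _).
  by apply: unif_prob_le => s /= /eqP ->.
apply: le_trans (prob_dvd_order_le _ d0 dy dw (leqnn _) eC) _.
rewrite ler_pdivrMr ?root4_gt0 // mulrC ler_pdivlMr ?exprn_gt0 //.
apply: le_trans (root4_le _ bd); rewrite mulnC expnM root4_exp4 -natrX -natrM ler_nat.
rewrite (_ : (C + 101 = 100 + C.+1)%N); last by lia.
rewrite expnD mulnC leq_mul2l; apply/orP; right.
apply: leq_trans (bin_leq_expn _ _) _; rewrite expnS.
apply: (@leq_trans ((2 * n) ^ C)); last by rewrite expnMn leq_mul.
by case: (C) nC => // c nc; rewrite leq_exp2r //; lia.
Unshelve. all: by end_near. Qed.

End Asymptotics.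

(** * The set of likely orders and its exponent *)

Local Open Scope classical_set_scope.
Local Open Scope ring_scope.

Theorem theorem2 (R : realType) :
  exists M : nat -> set nat,
    [/\ (forall n m : nat, M n m -> (0 < m)%N),
        (fun n : nat => sup [set prob_ord_eq R n m | m in [set m : nat | (0 < m)%N /\ ~ M n m]] : R^o)
          =O_\oo (fun n : nat => n%:R ^- 100 : R^o)
      & exists2 eps : nat -> R,
          eps @ \oo --> (0 : R)
        & \forall n \near \oo, prob_ord_in R n (M n) <= n%:R `^ (-1 + eps n)].
Proof.
have [C eC] : exists C : nat, expR 3 <= C%:R :> R.
  exists (Num.truncn (expR 3 : R)).+1; apply: ltW.
  by have /andP [] := truncn_itv (expR_ge0 (3 : R)).
pose M n := [set m : nat | (0 < m)%N /\ n%:R ^- 100 < prob_ord_eq R n m].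
pose p n := prob_ord_in R n (M n) + n%:R^-1.
have p_gt0 n : (0 < n)%N -> 0 < p n.
  by move=> n0; rewrite ltr_wpDl ?unif_prob_ge0 // invr_gt0 ltr0n.
exists M; split; first by move=> n m [].
  apply/eqO_exP; exists 1 => //; near=> n; rewrite mul1r.
  set S := [set _ | _ in _].
  have b0 : 0 <= n%:R ^- 100 :> R by rewrite invr_ge0 exprn_ge0.
  (* The supremum of the empty set is 0 by convention. *)
  have [S0|S0] := eqVneq S set0; first by rewrite S0 sup0 normr0 normr_ge0.
  move/set0P: S0 => [r Sr].
  have ubS : ubound S (n%:R ^- 100).
    move=> _ [m [m0 nMm] <-]; rewrite leNgt; apply/negP => lt.
    by apply: nMm; split.
  rewrite [X in _ <= X]ger0_norm // ger0_norm; first by apply: ge_sup => //; exists r.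
  apply: le_trans (ub_le_sup _ Sr); last by exists (n%:R ^- 100).
  by case: Sr => m _ <-; apply: unif_prob_ge0.
(* Adding 1 / n to the probability makes the exponent nonnegative. *)
exists (fun n => 1 + ln (p n) / ln n%:R); last first.
  near=> n.
  have n1 : (1 < n)%N by near: n; apply: nbhs_infty_ge.
  have n0 : (0 < n)%N by apply: ltnW.
  have T0 : 0 < ln n%:R :> R by rewrite ln_gt0 // ltr1n.
  rewrite addKr powR_natE // divfK ?gt_eqF // lnK ?posrE ?p_gt0 //.
  by rewrite lerDl invr_ge0.
apply/cvgrPdist_le => e e0.
pose delta := Num.min 2^-1 (e / 2).
have d0 : 0 < delta by rewrite lt_min invr_gt0 ltr0n divr_gt0.
have d1 : delta <= 2^-1 by rewrite ge_min lexx.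
have d2 : 2 * delta <= e by rewrite mulrC -ler_pdivlMr // ge_min lexx orbT.
near=> n.
have n1 : (1 < n)%N by near: n; apply: nbhs_infty_ge.
have n0 : (0 < n)%N by apply: ltnW.
have T0 : 0 < ln n%:R :> R by rewrite ln_gt0 // ltr1n.
have [w lew] : exists w, unif_prob R
    [pred s : 'S_n | ~~ rich (n ^ (4 * (C + 101))) (w ^ 2) w #[s]%g] + n%:R^-1
      <= n%:R `^ (-1 + 2 * delta).
  by near: n; apply: near_prob_not_rich_le.
have rich_le : forall w m, (0 < m)%N ->
    rich (n ^ (4 * (C + 101))) (w ^ 2) w m -> prob_ord_eq R n m <= n%:R ^- 100.
  by near: n; apply: near_rich_prob_le.
(* A rich order is too improbable to lie in [M n]. *)
have pn : p n <= n%:R `^ (-1 + 2 * delta).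
  apply: le_trans lew; rewrite lerD2r; apply: unif_prob_le => s /= /set_mem [m0 lt].
  by apply: contraTN lt => /(rich_le _ _ m0); rewrite -leNgt.
have lnp : ln (p n) <= (-1 + 2 * delta) * ln n%:R.
  by rewrite -ln_powR ler_ln ?posrE ?p_gt0 ?powR_gt0 ?ltr0n.
have lnp' : - ln n%:R <= ln (p n).
  rewrite -lnV ?posrE ?ltr0n // ler_ln ?posrE ?p_gt0 ?invr_gt0 ?ltr0n //.
  by rewrite lerDr unif_prob_ge0.
rewrite sub0r normrN ger0_norm.
  by apply: le_trans d2; rewrite -lerBrDl ler_pdivrMr // addrC.
by rewrite -lerBlDl sub0r ler_pdivlMr // mulN1r.
Unshelve. all: by end_near. Qed.
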